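(* Let $T$ be a numerical semigroup, $I$ a non-empty set of non-negative integers, and $\emptyset\neq J\subseteq I$. Then, for all $\mathbf{s}\in S_J^I(T)$, we have $\mathsf{L}(\mathbf{s})=\mathsf{L}(|\mathbf{s}|_J)$, where the first set of lengths is computed in $S_J^I(T)$ and the second one in $T$. In particular, $\rho(S_J^I(T))=\rho(T)$ and $\operatorname{LD}(S_J^I(T))=\operatorname{LD}(T)$.
   Context: $\mathbb{N}$ is the set of non-negative integers. For a non-empty set $I\subseteq\mathbb{N}$, $\mathbb{N}^{(I)}$ is the additive monoid (componentwise addition) of all sequences $(n_i)_{i\in I}$ of non-negative integers with $n_i=0$ for all but finitely many $i$; $\mathbf{0}$ is the zero sequence. A numerical semigroup is a submonoid $T$ of $(\mathbb{N},+)$ with $\mathbb{N}\setminus T$ finite. For $\emptyset\ne J\subseteq I$ and $\mathbf{x}=(x_i)_{i\in I}\in\mathbb{N}^{(I)}$, put $|\mathbf{x}|_J=\sum_{j\in J}x_j$, and define the submonoid $S_J^I(T)=\{\mathbf{x}\in\mathbb{N}^{(I)}:|\mathbf{x}|_J\in T\setminus\{0\}\}\cup\{\mathbf{0}\}$ of $\mathbb{N}^{(I)}$. For $M$ equal to $T$ or $S_J^I(T)$, with $M^*=M\setminus\{0\}$, the set of atoms is $\mathcal{A}(M)=M^*\setminus(M^*+M^* )$; for $m\in M$, $\mathsf{L}(m)$ is the set of $n\in\mathbb{N}$ such that $m$ is a sum of $n$ (not necessarily distinct) atoms (with $\mathsf{L}(0)=\{0\}$); these sets are finite, and $\ell(m)=\min\mathsf{L}(m)$.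 The elasticity of $m\ne 0$ is $\rho(m)=\sup\mathsf{L}(m)/\min\mathsf{L}(m)$ and $\rho(M)=\sup\{\rho(m):m\in M,\ m\neq 0\}$. The length density of $m$ with $|\mathsf{L}(m)|\ge2$ is $\operatorname{LD}(m)=\dfrac{|\mathsf{L}(m)|-1}{\max\mathsf{L}(m)-\ell(m)}$ and $\operatorname{LD}(M)=\inf\{\operatorname{LD}(m):m\in M,\ |\mathsf{L}(m)|\ge 2\}$. *)

(* Defs.v *)
From HB Require Import structures.
From mathcomp Require Import all_boot all_order all_algebra.
From mathcomp Require Import finmap mathcomp_extra boolp classical_sets functions.
From mathcomp Require Import cardinality fsbigop reals constructive_ereal ereal.
Set Implicit Arguments.
Unset Strict Implicit.
Unset Printing Implicit Defensive.
Import Order.TTheory GRing.Theory Num.Theory.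
Local Open Scope classical_set_scope.
Local Open Scope ring_scope.

(* Factorization theory of a submonoid M, given as a subset of an ambient
   commutative monoid V. *)

Definition nonzero (V : nmodType) (M : set V) : set V := M `\ 0.

Definition atoms (V : nmodType) (M : set V) : set V :=
  nonzero M `\` [set x + y | x in nonzero M & y in nonzero M].

Definition lengths (V : nmodType) (M : set V) (m : V) : set nat :=
  [set n | exists2 a : 'I_n -> V,
             (forall i, atoms M (a i)) & m = \sum_(i < n) a i].

(* On nat, the infimum of a nonempty set is its minimum, and the supremum of a
   nonempty finite set is its maximum. *)
Definition min_length (V : nmodType) (M : set V) (m : V) : nat :=
  infimum 0%N (lengths M m).

Definition max_length (V : nmodType) (M : set V) (m : V) : nat :=
  supremum 0%N (lengths M m).

Definition elasticity (R : realType) (V : nmodType) (M : set V) (m : V) :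
    \bar R :=
  (ereal_sup [set n%:R%:E | n in lengths M m] / (min_length M m)%:R%:E)%E.

Definition monoid_elasticity (R : realType) (V : nmodType) (M : set V) :
    \bar R :=
  ereal_sup [set elasticity R M m | m in nonzero M].

Definition length_density (R : realType) (V : nmodType) (M : set V) (m : V) :
    R :=
  (#|` fset_set (lengths M m)|%:R - 1)
    / ((max_length M m)%:R - (min_length M m)%:R).

(* The infimum is taken in \bar R, so it is +oo when no element of M has two
   distinct lengths. *)
Definition monoid_length_density (R : realType) (V : nmodType) (M : set V) :
    \bar R :=
  ereal_inf [set (length_density R M m)%:E
            | m in [set m | M m /\ (`I_2 #<= lengths M m)%card]].

Definition numerical_semigroup (T : set nat) : Prop :=
  [/\ T 0%N, (forall x y, T x -> T y -> T (x + y)%N) & finite_set (~` T)].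

(* The sequences in N^(I) live in the monoid of all functions I -> nat with
   pointwise addition. *)
Definition finsupp_seq (I : set nat) : set (I -> nat) :=
  [set x | finite_set [set i | x i != 0%N]].

(* The finitely supported sum; it is the true sum for x in N^(I). *)
Definition partial_sum (I J : set nat) (x : I -> nat) : nat :=
  \sum_(j \in [set j : I | J (\val j)]) x j.

Definition S_monoid (I J T : set nat) : set (I -> nat) :=
  [set x | finsupp_seq x /\ nonzero T (partial_sum J x)] `|` [set 0].
Arguments S_monoid I J T : clear implicits.

(* Main.v *)
(* The map s |-> |s|_J is a transfer homomorphism from S_J^I(T) onto T: it is
   additive, maps exactly the nonzero elements to nonzero elements, and every
   decomposition |s|_J = a + b lifts to a decomposition s = x + y with
   |x|_J = a and |y|_J = b. Hence it preserves and reflects atoms, and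
   factorizations of |s|_J lift to factorizations of s of the same length.
   Elasticity and length density depend on the sets of lengths only. *)
Require Import Defs.
From mathcomp Require Import all_boot all_order all_algebra.
From mathcomp Require Import boolp classical_sets functions.
From mathcomp Require Import reals constructive_ereal ereal.
From mathcomp Require Import cardinality fsbigop.
Local Open Scope classical_set_scope.
Set Implicit Arguments.
Unset Strict Implicit.
Import GRing.Theory.
Local Open Scope ring_scope.

Section PartialSum.
Variables I J : set nat.
Implicit Types (x y s : I -> nat) (j : I) (a b n : nat).

Lemma finsupp_seq0 : finsupp_seq (0 : I -> nat).
Proof. by apply: (@sub_finite_set _ _ set0) => // i /=; rewrite eqxx. Qed.

(** Nothing cancels in [nat], so the support of [x + y] is the union of the supports of [x] and
    [y]. *)
Lemma finsupp_seqD x y : finsupp_seq (x + y) <-> finsupp_seq x /\ finsupp_seq y.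
Proof.
rewrite -finite_setU /finsupp_seq /=; split; apply: sub_finite_set => i /=;
  by rewrite (addn_eq0 (x i)) negb_and => /orP.
Qed.

Lemma partial_sum0 : partial_sum J (0 : I -> nat) = 0%N.
Proof. exact: fsbig1. Qed.

Lemma partial_sumD x y : finsupp_seq (x + y) ->
  partial_sum J (x + y) = (partial_sum J x + partial_sum J y)%N.
Proof.
move=> xyfin; rewrite /partial_sum.
set A := [set j : I | J (\val j)]; set D := A `&` [set i | (x + y) i != 0%N].
(* [A] may be infinite. The sums of [x], [y] and [x + y] can all be restricted to the finite set
   [D], since each of the three vanishes wherever [x + y] does. *)
have widen (z : I -> nat) : (forall i, (z i <= x i + y i)%N) ->
    \sum_(j \in A) z j = \sum_(j \in D) z j.
  move=> le_z; apply/esym/fsbig_widen => [i []//|i [Ai /not_andP[//|/=]]].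
  by move=> /negP/negPn/eqP xy0; apply/eqP; rewrite -leqn0 -xy0.
rewrite !widen //; first last.
- by move=> i; exact: leq_addr.
- by move=> i; exact: leq_addl.
by apply: fsbig_split; apply: finite_setIr.
Qed.

Definition single j n : I -> nat := fun i => if i == j then n else 0%N.

Lemma finsupp_single j n : finsupp_seq (single j n).
Proof.
apply: (@sub_finite_set _ _ [set j]) => // i /=.
by rewrite /single; case: (i =P j).
Qed.

Lemma partial_sum_single j n : J (\val j) -> partial_sum J (single j n) = n.
Proof.
move=> Jj; rewrite /partial_sum -(@fsbig_widen _ _ _ _ [set j]).
- by rewrite fsbig_set1 /single eqxx.
- by move=> _ ->.
- by move=> i [_ /= /eqP/negPf ij]; rewrite /single ij.
Qed.

(** Induction on [a]: units are moved one at a time from coordinates of [s] in [J] to [x].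
    Coordinates outside [J] stay in [y]. *)
Lemma partial_sum_split s a b : finsupp_seq s -> partial_sum J s = (a + b)%N ->
  exists x y, [/\ s = x + y, partial_sum J x = a & partial_sum J y = b].
Proof.
elim: a s => [|a IHa] s sfin sab.
  by exists 0, s; rewrite add0r partial_sum0.
have [j Jj sj0] : exists2 j : I, J (\val j) & s j != 0%N.
  apply: contrapT => /forall2NP sN; suff : partial_sum J s = 0%N by rewrite sab.
  by apply: fsbig1 => i Ji; case: (sN i) => // /negP/negPn/eqP.
pose s' : I -> nat := fun i => if i == j then (s j).-1 else s i.
have sE : s = single j 1 + s'.
  apply/funext => i; rewrite addrfctE /single /s'; case: eqP => [->|//].
  by rewrite -[LHS]prednK ?lt0n.
have [_ s'fin] : finsupp_seq (single j 1) /\ finsupp_seq s'.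
  by apply/finsupp_seqD; rewrite -sE.
have s'ab : partial_sum J s' = (a + b)%N.
  (* Removing one unit at [j] lowers the partial sum from [a.+1 + b] to [a + b]. *)
  by move: sab; rewrite {1}sE partial_sumD -?sE // partial_sum_single // => -[].
have [x [y [s'E xa yb]]] := IHa s' s'fin s'ab.
have s1E : s = single j 1 + x + y by rewrite sE s'E addrA.
exists (single j 1 + x), y; split=> //.
have [s1xfin _] : finsupp_seq (single j 1 + x) /\ finsupp_seq y.
  by apply/finsupp_seqD; rewrite -s1E.
by rewrite partial_sumD // partial_sum_single // xa.
Qed.

End PartialSum.

Section Lengths.
Variables I J T : set nat.
Hypothesis T0 : T 0%N.
Local Notation S := (S_monoid I J T).
Implicit Types (x y s : I -> nat).

Lemma nonzero_S_monoid s :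
  nonzero S s <-> finsupp_seq s /\ nonzero T (partial_sum J s).
Proof.
split=> [[[//|//]]|[sfin sT]]; split; first by left.
by move=> /= s0; case: sT => _; apply; rewrite s0 partial_sum0.
Qed.

Lemma S_monoid_finsupp s : S s -> finsupp_seq s.
Proof. by case=> [[]//|->]; exact: finsupp_seq0. Qed.

Lemma S_monoid_partial_sum s : S s -> T (partial_sum J s).
Proof. by case=> [[_ []]//|->]; rewrite partial_sum0. Qed.

(** A sequence supported outside [J] also has partial sum 0, but the definition of [S] admits only
    the zero sequence among these. *)
Lemma S_monoid_partial_sum_eq0 s : S s -> partial_sum J s = 0%N -> s = 0.
Proof. by move=> [[_ [_ nz]] /nz|]. Qed.

Lemma S_monoid_single (j : I) n : J (\val j) -> T n -> S (single j n).
Proof.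
move=> Jj; case: n => [|n] Tn.
  by right; apply/funext => i; rewrite /single; case: eqP.
by left; split; [exact: finsupp_single|split; rewrite partial_sum_single].
Qed.

(** Decompositions into nonzero elements pass both ways: from [T] to [S] by [partial_sum_split],
    from [S] to [T] by additivity. *)
Lemma atoms_S_monoid s :
  atoms S s <-> finsupp_seq s /\ atoms T (partial_sum J s).
Proof.
split.
  move=> [/nonzero_S_monoid[sfin sT] sN]; split=> //; split=> //.
  move=> [a aT [b bT /esym abE]]; apply: sN.
  have [x [y [sE xa yb]]] := partial_sum_split sfin abE.
  have [xfin yfin] : finsupp_seq x /\ finsupp_seq y.
    by apply/finsupp_seqD; rewrite -sE.
  exists x; first by apply/nonzero_S_monoid; rewrite xa.
  by exists y => //; apply/nonzero_S_monoid; rewrite yb.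
move=> [sfin [sT sN]]; split; first exact/nonzero_S_monoid.
move=> [x /nonzero_S_monoid[_ xT] [y /nonzero_S_monoid[_ yT] xyE]].
apply: sN; exists (partial_sum J x) => //; exists (partial_sum J y) => //.
by rewrite -xyE partial_sumD ?xyE.
Qed.

(** Finite support is carried through the induction because [partial_sumD] requires it. *)
Lemma partial_sum_sum_atoms n (a : 'I_n -> I -> nat) :
  (forall i, atoms S (a i)) ->
  finsupp_seq (\sum_(i < n) a i) /\
  partial_sum J (\sum_(i < n) a i) = \sum_(i < n) partial_sum J (a i).
Proof.
elim: n a => [|n IHn] a aS.
  by rewrite !big_ord0 partial_sum0; split=> //; exact: finsupp_seq0.
rewrite !big_ord_recl.
have [fin sumE] := IHn (fun i => a (lift ord0 i)) (fun i => aS _).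
have /atoms_S_monoid[fin0 _] := aS ord0.
have finD : finsupp_seq (a ord0 + \sum_(i < n) a (lift ord0 i)).
  exact/finsupp_seqD.
by split=> //; rewrite partial_sumD // sumE.
Qed.

(** At least one factor is required: the last one absorbs what remains of [s], including its
    coordinates outside [J]. With no factor, a zero partial sum would not give [s = 0]. *)
Lemma lift_factorization n s (b : 'I_n.+1 -> nat) : finsupp_seq s ->
  (forall i, atoms T (b i)) -> partial_sum J s = \sum_(i < n.+1) b i ->
  lengths S s n.+1.
Proof.
elim: n s b => [|n IHn] s b sfin bT sE.
  exists (fun=> s); last by rewrite big_ord1.
  by move=> _; apply/atoms_S_monoid; rewrite sE big_ord1.
rewrite big_ord_recl in sE.
have [x [y [xyE xb yb]]] := partial_sum_split sfin sE.
have [xfin yfin] : finsupp_seq x /\ finsupp_seq y.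
  by apply/finsupp_seqD; rewrite -xyE.
have [a aS yE] := IHn y _ yfin (fun i => bT _) yb.
exists (fun i => if unlift ord0 i is Some k then a k else x).
  move=> i; case: unliftP => [k _|_]; first exact: aS.
  by apply/atoms_S_monoid; rewrite xb.
rewrite big_ord_recl unlift_none xyE yE; congr (_ + _).
by apply: eq_bigr => i _; rewrite liftK.
Qed.

Lemma lengths_S_monoid s : S s -> lengths S s = lengths T (partial_sum J s).
Proof.
move=> Ss; apply/seteqP; split=> [n [a aS sE]|[|n] [b bT sE]].
- have [_ sumE] := partial_sum_sum_atoms aS.
  exists (fun i => partial_sum J (a i)); last by rewrite sE sumE.
  by move=> i; have /atoms_S_monoid[] := aS i.
(* Length 0: the partial sum is an empty sum, and membership in [S] then forces [s = 0]. *)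
- exists (fun=> 0); first by case.
  by rewrite big_ord0; apply: S_monoid_partial_sum_eq0; rewrite // sE big_ord0.
- exact: lift_factorization (S_monoid_finsupp Ss) bT sE.
Qed.

End Lengths.

Theorem proposition7p3 (R : realType) (T I J : set nat)
    (hT : numerical_semigroup T) (hI : I !=set0) (hJ : J !=set0)
    (hJI : J `<=` I) :
  [/\ forall s : I -> nat, S_monoid I J T s ->
        lengths (S_monoid I J T) s = lengths T (partial_sum J s),
      monoid_elasticity R (S_monoid I J T) = monoid_elasticity R T
    & monoid_length_density R (S_monoid I J T)
        = monoid_length_density R T].
Proof.
have [T0 _ _] := hT.
have lenE (s : I -> nat) : S_monoid I J T s ->
    lengths (S_monoid I J T) s = lengths T (partial_sum J s).
  exact: lengths_S_monoid.
have [j0 Jj0] := hJ.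
(* For a fixed index in [J], [single j] is a section of [partial_sum J], so every element of [T] is
   the partial sum of an element of [S]. *)
pose j : I := SigSub (mem_set (hJI _ Jj0)).
have psE n : partial_sum J (single j n) = n by exact: partial_sum_single.
have Sj n : T n -> S_monoid I J T (single j n) by exact: S_monoid_single.
split=> //.
- rewrite /monoid_elasticity; congr ereal_sup.
  have elE (s : I -> nat) : S_monoid I J T s ->
      elasticity R (S_monoid I J T) s = elasticity R T (partial_sum J s).
    by move=> Ss; rewrite /elasticity /min_length lenE.
  (* Both suprema range over the same values: [partial_sum J] carries witnesses from [S] to [T], and
     [single j] carries them back. *)
  apply/seteqP; split=> _ [m mM <-].
    exists (partial_sum J m); last by rewrite elE //; case: mM.
    by case/nonzero_S_monoid: mM.
  exists (single j m); last by rewrite elE ?psE //; apply: Sj; case: mM.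
  by apply/nonzero_S_monoid; rewrite psE; split=> //; exact: finsupp_single.
- rewrite /monoid_length_density; congr ereal_inf.
  have ldE (s : I -> nat) : S_monoid I J T s ->
      length_density R (S_monoid I J T) s = length_density R T (partial_sum J s).
    by move=> Ss; rewrite /length_density /min_length /max_length lenE.
  (* The same two maps serve here; by [lenE] they also preserve the condition of having two distinct
     lengths. *)
  apply/seteqP; split=> _ [m [mM m2] <-].
    exists (partial_sum J m); last by rewrite ldE.
    by split; [exact: S_monoid_partial_sum mM|rewrite -lenE].
  exists (single j m); last by rewrite ldE ?psE //; exact: Sj.
  by split; [exact: Sj|rewrite lenE ?psE //; exact: Sj].
Qed.
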